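(* Let $s=(s_0,s_1,s_2)$ with $2=s_0\le s_1\le s_2$. For every integer $n>1$, the $\ell_\infty$ diameter of $P_n(s)$, i.e. $\sup_{x,y\in P_n(s)}\|x-y\|_\infty$, is greater than $(s_1+s_2)\lfloor n/2\rfloor^2/4$.
   Context: For an integer $n\ge1$ let $V(\mathbb{T}_n)=(\mathbb{Z}/n\mathbb{Z})^2$ be the vertex set of the discrete torus obtained from the triangular lattice $\mathbb{Z}+\mathbb{Z}\omega$, $\omega=e^{2\pi i/3}$, modulo $n$ (with $1\mapsto(1,0)$, $\omega\mapsto(0,1)$). For $f:V(\mathbb{T}_n)\to\mathbb{R}$ the discrete Hessian on the three families $E_0,E_1,E_2$ of unit rhombi is given by $D_0f(a,b)=f(a,b)+f(a+2,b+1)-f(a+1,b)-f(a+1,b+1)$, $D_1f(a,b)=f(a+1,b)+f(a,b+1)-f(a,b)-f(a+1,b+1)$, $D_2f(a,b)=f(a,b)+f(a+1,b+2)-f(a+1,b+1)-f(a,b+1)$. For $s=(s_0,s_1,s_2)\in\mathbb{R}_{>0}^3$, $P_n(s)$ is the bounded convex polytope of all $g:V(\mathbb{T}_n)\to\mathbb{R}$ with $\sum_v g(v)=0$ and $D_rg(v)\le s_r$ for all $v$ and $r\in\{0,1,2\}$. $\|g\|_\infty=\max_v|g(v)|$. *)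

(* Defs.v *)
From HB Require Import structures.
From mathcomp Require Import all_boot all_order all_algebra.
From mathcomp Require Import all_classical all_reals ereal.
Set Implicit Arguments.
Unset Strict Implicit.
Unset Printing Implicit Defensive.
Import Order.TTheory GRing.Theory Num.Theory.
Local Open Scope classical_set_scope.
Local Open Scope ring_scope.

(* The lattice point a + b * omega is the pair (a, b).  'Z_n is Z/nZ only for
   1 < n ('Z_1 is Z/2Z), so these definitions are meant for 1 < n. *)
Definition torus (n : nat) : finType := ('Z_n * 'Z_n)%type.

Section Hessian.
Variables (R : realType) (n : nat).
Implicit Types (f : {ffun torus n -> R}) (a b : 'Z_n).

Definition D0 f a b : R :=
  f (a, b) + f (a + 2, b + 1) - f (a + 1, b) - f (a + 1, b + 1).

Definition D1 f a b : R :=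
  f (a + 1, b) + f (a, b + 1) - f (a, b) - f (a + 1, b + 1).

Definition D2 f a b : R :=
  f (a, b) + f (a + 1, b + 2) - f (a + 1, b + 1) - f (a, b + 1).

Definition polytope (s0 s1 s2 : R) : set {ffun torus n -> R} :=
  [set g : {ffun torus n -> R} | \sum_(v : torus n) g v = 0 /\
     forall a b : 'Z_n, [/\ D0 g a b <= s0, D1 g a b <= s1 & D2 g a b <= s2]].

Definition linf_norm (g : {ffun torus n -> R}) : R :=
  \big[Num.max/0]_(v : torus n) `|g v|.

(* The supremum is taken in the extended reals, which avoids the junk value of
   the real-valued sup on unbounded sets. *)
Definition linf_diameter (A : set {ffun torus n -> R}) : \bar R :=
  ereal_sup [set (linf_norm (x - y))%:E | x in A & y in A].

End Hessian.

Arguments polytope {R} n s0 s1 s2 _ : assert.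

(* Main.v *)
Require Import Defs.
From HB Require Import structures.
From mathcomp Require Import all_boot all_order all_algebra.
From mathcomp Require Import all_classical all_reals ereal.
From mathcomp Require Import ring lra.
Import Order.TTheory GRing.Theory Num.Theory.
Local Open Scope classical_set_scope.
Local Open Scope ring_scope.

(** A function of [b] alone is annihilated by [D0] and [D1], and [D2] acts on it
    as the second difference along the cycle [Z/nZ]; a function of [a - b] alone
    is annihilated by [D0] and [D2], and [D1] acts on it as the second
    difference.  So if [q] is a periodic function whose second differences are
    at most 1, then [s1 * q (a - b) + s2 * q b], recentred to have mean zero,
    lies in the polytope as soon as the three bounds are nonnegative
    ([ridge_bounds]).  The best such [q] is the periodic parabola
    [- k (n - k) / 2]: its second difference is 1 except at the cusp [k = 0],
    where it is negative ([parabola_second_difference]).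

    Since [a - b] and [b] are independent coordinates of the torus, both terms
    can be extremal at once, and with [m] the half of [n] rounded down the
    function drops by [(s1 + s2) m (n - m) / 2] from [(0, 0)] to [(2 m, m)].
    Translations preserve the polytope, so comparing the function with a
    translate of itself turns the whole drop into a distance between two points
    of the polytope ([linf_diameter_ge_drop]).  As [m <= n - m], that is at least
    twice the bound to be exceeded, and the bound is positive. *)

Section Polytope.
Variables (R : realType) (n : nat).
Implicit Types f g : {ffun torus n -> R}.

Definition hessian_le (s0 s1 s2 : R) f :=
  forall a b : 'Z_n, [/\ D0 f a b <= s0, D1 f a b <= s1 & D2 f a b <= s2].

Definition center f : {ffun torus n -> R} :=
  [ffun v => f v - (\sum_u f u) / #|torus n|%:R].

Definition translate (w : torus n) f : {ffun torus n -> R} :=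
  [ffun v => f (v.1 + w.1, v.2 + w.2)].

Lemma center_polytope (s0 s1 s2 : R) f :
  hessian_le s0 s1 s2 f -> polytope n s0 s1 s2 (center f).
Proof.
move=> hf; split.
  under eq_bigr do rewrite ffunE.
  rewrite sumrB sumr_const -[X in _ - X]mulr_natr divfK; first exact: subrr.
  by rewrite pnatr_eq0 -lt0n; apply/card_gt0P; exists (0, 0).
move=> a b; case: (hf a b); rewrite /D0 /D1 /D2 !ffunE => h0 h1 h2.
by split; lra.
Qed.

Lemma translate_polytope (s0 s1 s2 : R) w f :
  polytope n s0 s1 s2 f -> polytope n s0 s1 s2 (translate w f).
Proof.
case=> sum0 hf; split; last first.
  move=> a b; case: (hf (a + w.1) (b + w.2)).
  rewrite /D0 /D1 /D2 !ffunE /=.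
  by rewrite !(addrAC _ w.1) !(addrAC _ w.2).
rewrite -[RHS]sum0.
rewrite [RHS](reindex_onto (fun v : torus n => (v.1 + w.1, v.2 + w.2))
                (fun v : torus n => (v.1 - w.1, v.2 - w.2))) /=; last first.
  by move=> [a b] _ /=; rewrite !subrK.
apply: eq_big => [[a b]|v _]; last by rewrite ffunE.
by rewrite /= !addrK eqxx.
Qed.

Lemma ler_linf_norm g v : `|g v| <= linf_norm g.
Proof. exact: (le_bigmax _ (fun v => `|g v|)). Qed.

(** The function and its translate by [w - v], both recentred by the same mean,
    differ at [v] by exactly [f v - f w]; no factor 2 is lost to the mean. *)
Lemma linf_diameter_ge_drop (s0 s1 s2 : R) f (v w : torus n) :
  hessian_le s0 s1 s2 f ->
  ((f v - f w)%:E <= linf_diameter (polytope n s0 s1 s2))%E.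
Proof.
move=> /(center_polytope s0 s1 s2) Pf; set g := center f in Pf.
pose u : torus n := (w.1 - v.1, w.2 - v.2).
apply: (@le_trans _ _ (linf_norm (g - translate u g))%:E).
  rewrite lee_fin; apply: le_trans (ler_linf_norm _ v).
  have -> : (g - translate u g) v = f v - f w.
    rewrite !ffunE /= !(addrC v.1) !(addrC v.2) !subrK -surjective_pairing.
    ring.
  exact: ler_norm.
apply: ereal_sup_ubound; exists g => //; exists (translate u g) => //.
exact: translate_polytope.
Qed.

End Polytope.

Section Ridge.
Variable R : realType.

Definition parabola n (k : 'Z_n) : R := - ((k : nat)%:R * (n%:R - (k : nat)%:R)) / 2.

Lemma parabola0 n : parabola n 0 = 0.
Proof. by rewrite /parabola mul0r oppr0 mul0r. Qed.

Lemma parabola_le0 n (k : 'Z_n) : (1 < n)%N -> parabola n k <= 0.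
Proof.
move=> n_gt1; rewrite /parabola mulNr oppr_le0 divr_ge0 //.
rewrite mulr_ge0 // subr_ge0 ler_nat.
by rewrite -[leqRHS](Zp_cast n_gt1) ltnW.
Qed.

(** The wrap-around is harmless for the step into the cusp, because the
    quadratic [- k (n - k) / 2] takes the same value at [k = n] and [k = 0]. *)
Lemma parabolaS n (k : 'Z_n) : (1 < n)%N ->
  parabola n (k + 1) =
  - ((k : nat).+1%:R * (n%:R - (k : nat).+1%:R)) / 2.
Proof.
case: n k => [|[|n]] // k _; rewrite /parabola /=.
have: (k < n.+2)%N := ltn_ord k.
rewrite modnDmr addn1 leq_eqVlt => /orP[/eqP-> | lt_k].
  by rewrite modnn subrr mulr0 mul0r.
by rewrite modn_small.
Qed.

Lemma parabola_second_difference n (k : 'Z_n) : (1 < n)%N ->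
  parabola n k + parabola n (k + 2) - 2 * parabola n (k + 1) <= 1.
Proof.
move=> n_gt1; have [k1_0|k1_neq0] := eqVneq (k + 1) 0.
  rewrite k1_0 parabola0.
  have := parabola_le0 _ k n_gt1; have := parabola_le0 _ (k + 2) n_gt1; lra.
have k1E : (k + 1 : 'Z_n) = (k : nat).+1 :> nat.
  case: n k n_gt1 k1_neq0 => [|[|n]] // k _; rewrite -val_eqE /=.
  have: (k < n.+2)%N := ltn_ord k.
  rewrite modnDmr addn1 leq_eqVlt => /orP[/eqP-> | lt_k _].
    by rewrite modnn.
  by rewrite modn_small.
have -> : k + 2 = k + 1 + 1 by ring.
rewrite !parabolaS // k1E /parabola -[k.+2%:R]natr1 -[k.+1%:R]natr1; lra.
Qed.

Definition ridge n (s1 s2 : R) : {ffun torus n -> R} :=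
  [ffun v => s1 * parabola n (v.1 - v.2) + s2 * parabola n v.2].

Lemma ridge_bounds n (s0 s1 s2 : R) : (1 < n)%N ->
  0 <= s0 -> 0 <= s1 -> 0 <= s2 -> hessian_le R n s0 s1 s2 (ridge n s1 s2).
Proof.
move=> n_gt1 s0_ge0 s1_ge0 s2_ge0 a b; rewrite /D0 /D1 /D2 !ffunE /=.
have -> : a + 2 - (b + 1) = a - b + 1 by ring.
have -> : a + 1 - (b + 1) = a - b by ring.
have -> : a + 1 - b = a - b + 1 by ring.
have -> : a + 1 - (b + 2) = a - (b + 1) by ring.
split; first lra.
- (* The second difference of the term in [a - b] is centred at [a - b]. *)
  have := parabola_second_difference _ (a - (b + 1)) n_gt1.
  have -> : a - (b + 1) + 2 = a - b + 1 by ring.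
  have -> : a - (b + 1) + 1 = a - b by ring.
  by move/(ler_wpM2l s1_ge0); lra.
- by have := ler_wpM2l s2_ge0 (parabola_second_difference _ b n_gt1); lra.
Qed.

End Ridge.

Theorem lemma3p17 (R : realType) (s0 s1 s2 : R) (n : nat) :
  s0 = 2 -> s0 <= s1 -> s1 <= s2 -> (1 < n)%N ->
  (((s1 + s2) * (n %/ 2)%:R ^+ 2 / 4)%:E
     < linf_diameter (polytope n s0 s1 s2))%E.
Proof.
move=> s0E s01 s12 n_gt1; set m := (n %/ 2)%N.
have m_gt0 : 0 < m%:R :> R by rewrite ltr0n divn_gt0.
have m2_le : 2 * m%:R <= n%:R :> R.
  by rewrite -natrM ler_nat mulnC leq_trunc_div.
have m_val : (m%:R : 'Z_n) = m :> nat.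
  by rewrite val_Zp_nat // modn_small // ltn_Pdiv // ltnW.
have bounds : hessian_le R n s0 s1 s2 (ridge R n s1 s2).
  by apply: ridge_bounds => //; lra.
apply: lt_le_trans (linf_diameter_ge_drop _ _ _ _ _ _ (0, 0) (m%:R + m%:R, m%:R) bounds).
rewrite lte_fin !ffunE /= subr0 addrK parabola0 /parabola m_val.
have h1 : 0 < (s1 + s2) * m%:R ^+ 2 by rewrite mulr_gt0 ?exprn_gt0 //; lra.
have h2 : 0 <= (s1 + s2) * (m%:R * (n%:R - 2 * m%:R)).
  by rewrite mulr_ge0 ?mulr_ge0 ?subr_ge0 //; lra.
lra.
Qed.
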